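(* For every sufficiently large integer $k$, we have \[ \frac{1}{2}\log(2k+1) \leq M'_k \leq M_k \leq 2k . \]
   Context: Logarithms are to base 2. A tournament is an orientation of a complete graph. For a digraph $D$ and $X \subseteq V(D)$, inverting $X$ means reversing the direction of every arc of $D$ with both endvertices in $X$. A digraph $D$ is $k$-arc-strong if for every partition $(V_1,V_2)$ of $V(D)$ into nonempty sets there are at least $k$ arcs from $V_1$ to $V_2$; it is $k$-strong if $|V(D)|\ge k+1$ and $D-S$ is strongly connected for every $S\subseteq V(D)$ with $|S|<k$. $\mathrm{sinv}'_k(D)$ (resp. $\mathrm{sinv}_k(D)$) is the minimum number of sets whose successive inversion transforms $D$ into a $k$-arc-strong (resp. $k$-strong) digraph. $M_k = \max\{\mathrm{sinv}_k(T) : T \text{ tournament of order at least } 2k+1\}$ and $M'_k = \max\{\mathrm{sinv}'_k(T) : T \text{ tournament of order at least } 2k+1\}$. *)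

(* Defs.v *)
From Stdlib Require Import Reals.
From mathcomp Require Import all_boot.

Set Implicit Arguments.
Unset Strict Implicit.
Unset Printing Implicit Defensive.

(* A digraph on vertex set 'I_n is a relation D : rel 'I_n (D x y = arc x -> y). *)

Definition is_tournament (n : nat) (D : rel 'I_n) : Prop :=
  (forall x, ~~ D x x) /\ (forall x y, x != y -> D x y != D y x).

Definition invert (n : nat) (D : rel 'I_n) (X : {set 'I_n}) : rel 'I_n :=
  fun x y => if (x \in X) && (y \in X) then D y x else D x y.

Definition invert_seq (n : nat) (D : rel 'I_n) (Xs : seq {set 'I_n}) : rel 'I_n :=
  foldl (@invert n) D Xs.

Definition k_arc_strong (n k : nat) (D : rel 'I_n) : Prop :=
  forall V1 : {set 'I_n}, V1 != set0 -> ~: V1 != set0 ->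
    k <= #|[set p : 'I_n * 'I_n | [&& p.1 \in V1, p.2 \in ~: V1 & D p.1 p.2]]|.

Definition strong_minus (n : nat) (D : rel 'I_n) (S : {set 'I_n}) : Prop :=
  forall x y, x \notin S -> y \notin S ->
    connect (fun a b => [&& D a b, a \notin S & b \notin S]) x y.

Definition k_strong (n k : nat) (D : rel 'I_n) : Prop :=
  k.+1 <= n /\ forall S : {set 'I_n}, #|S| < k -> strong_minus D S.

Definition is_sinv_arc (n k : nat) (D : rel 'I_n) (s : nat) : Prop :=
  (exists Xs : seq {set 'I_n}, size Xs = s /\ k_arc_strong k (invert_seq D Xs)) /\
  (forall Xs : seq {set 'I_n}, k_arc_strong k (invert_seq D Xs) -> s <= size Xs).

Definition is_sinv (n k : nat) (D : rel 'I_n) (s : nat) : Prop :=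
  (exists Xs : seq {set 'I_n}, size Xs = s /\ k_strong k (invert_seq D Xs)) /\
  (forall Xs : seq {set 'I_n}, k_strong k (invert_seq D Xs) -> s <= size Xs).

(* M'_k = m : the maximum of sinv'_k(T) over tournaments T of order >= 2k+1
   exists (every such T has a finite sinv'_k bounded by m) and equals m. *)
Definition is_M_arc (k m : nat) : Prop :=
  (forall (n : nat) (T : rel 'I_n), is_tournament T -> (2 * k).+1 <= n ->
     exists s, is_sinv_arc k T s /\ s <= m) /\
  (exists (n : nat) (T : rel 'I_n),
     [/\ is_tournament T, (2 * k).+1 <= n & is_sinv_arc k T m]).

Definition is_M (k m : nat) : Prop :=
  (forall (n : nat) (T : rel 'I_n), is_tournament T -> (2 * k).+1 <= n ->
     exists s, is_sinv k T s /\ s <= m) /\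
  (exists (n : nat) (T : rel 'I_n),
     [/\ is_tournament T, (2 * k).+1 <= n & is_sinv k T m]).

Definition log2 (x : R) : R := Rdiv (ln x) (ln (INR 2)).

(* Main.v *)
Require Import Defs.
From Stdlib Require Import Reals Lra.
From mathcomp Require Import all_boot zify.

(** Upper bound.  Inverting the [i]-th vertex together with the later vertices to
    which its arc is wrong corrects all arcs between it and later vertices, so [2k]
    inversions give the first [2k] vertices any prescribed arcs.  Choosing those of
    the rotational tournament on [2k + 1] vertices, one of whose vertices is blown up
    into all remaining ones, yields a [k]-strong tournament, whatever the arcs
    inside the blown-up class are.

    Lower bound.  On [n = 2k + 1] vertices, [k]-arc-strong means regular, so some
    tournament needs more than [s] inversions as soon as the proportion of regular
    tournaments is below [2 ^ (- n * s)].  By Fourier inversion this proportion is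
    the mean of [prod_(x < y) cos (a_x - a_y)] over angles [a_x].  AM-GM bounds the
    product by [exp (- (n ^ 2 - |S| ^ 2) / 8)], where [S] is the sum of the unit vectors
    of angle [2 * a_x].  Linearizing [|S| ^ 2] on a grid of integer points makes the mean
    factor over the vertices, and comparing the exponential with a power of a
    cosine bounds it by about [(10 / (11 * n)) ^ (n / 2)], up to polynomial
    factors.  This is exponentially smaller than [n ^ (- n / 2)], which is what
    [4 ^ s < n] requires. *)

Set Implicit Arguments.
Unset Strict Implicit.
Unset Printing Implicit Defensive.

(** Since [4 ^ m] is [2 ^ (2 * m)], taking logarithms gives the factor one half; all other work on
    the lower bound can thus use the integer inequality. *)
Lemma half_log2_le (n m : nat) : 0 < n -> n <= 4 ^ m ->
  Rle (Rmult (Rinv (INR 2)) (log2 (INR n))) (INR m).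
Proof.
move=> n0 le_n; rewrite /log2.
have n0R : Rlt 0 (INR n) by apply: lt_0_INR; apply/ltP.
have powE : INR (4 ^ m) = pow 2 (2 * m).
  elim: m {le_n} => [|m IH] //; rewrite expnS mult_INR IH.
  have -> : 2 * m.+1 = (2 * m).+2 by lia.
  by rewrite /=; ring.
have le_ln : Rle (ln (INR n)) (Rmult (INR (2 * m)) (ln 2)).
  rewrite -ln_pow; last lra; rewrite -powE.
  have [lt_n|->] : Rle (INR n) (INR (4 ^ m)) by apply: le_INR; apply/leP.
    by left; apply: ln_increasing.
  by right.
have ln2 : Rlt 0 (ln 2) by rewrite -ln_1; apply: ln_increasing; lra.
have -> : INR 2 = IZR 2 by [].
move: le_ln; rewrite mult_INR => le_ln.
apply: (Rmult_le_reg_l (Rmult 2 (ln 2))); first by lra.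
have -> : Rmult (Rmult 2 (ln 2)) (Rmult (Rinv 2) (Rdiv (ln (INR n)) (ln 2))) = ln (INR n).
  by field; lra.
by move: le_ln => /=; lra.
Qed.

(** * Upper bound *)

Lemma invert_tournament n (D : rel 'I_n) (X : {set 'I_n}) :
  is_tournament D -> is_tournament (invert D X).
Proof.
move=> [Dirr Dasym]; split=> [x|x y neq_xy]; first by rewrite /invert; case: ifP.
rewrite /invert andbC; case: ifP => _; last exact: Dasym.
by apply: Dasym; rewrite eq_sym.
Qed.

Lemma invert_seq_tournament n (D : rel 'I_n) Xs :
  is_tournament D -> is_tournament (invert_seq D Xs).
Proof.
rewrite /invert_seq; elim: Xs D => //= X Xs IH D tD.
by apply: IH; apply: invert_tournament.
Qed.

(** The rotational tournament: [a] beats the [k] residues after it modulo [2 * k + 1]. The modulus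
    is added before subtracting so that truncated subtraction does no harm. *)
Definition circular_arc k (a b : nat) : bool :=
  0 < (b + (2 * k).+1 - a) %% (2 * k).+1 <= k.

(* Every vertex of index at least [2 * k] plays the role of the vertex [2 * k]
   of the rotational tournament on [2 * k + 1] vertices. *)
Definition blowup_class k n (x : 'I_n) : nat := minn x (2 * k).

Definition has_circular_arcs k n (D : rel 'I_n) : Prop :=
  forall x y : 'I_n, blowup_class k x != blowup_class k y ->
    D x y = circular_arc k (blowup_class k x) (blowup_class k y).

(** The two cyclic differences are positive and add up to [2 * k + 1], so exactly one of them is at
    most [k]. *)
Lemma circular_arc_asym k a b : a <= 2 * k -> b <= 2 * k -> a != b ->
  circular_arc k b a = ~~ circular_arc k a b.
Proof.
move=> ak bk neq_ab; rewrite /circular_arc.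
have modE c d : c <= 2 * k -> d <= 2 * k ->
    (d + (2 * k).+1 - c) %% (2 * k).+1 = if c <= d then d - c else d + (2 * k).+1 - c.
  move=> ck dk; case: leqP => cd.
    by rewrite addnC -addnBA // modnDl modn_small //; lia.
  by rewrite modn_small //; lia.
by rewrite !modE //; case: (ltngtP a b) neq_ab => //; lia.
Qed.

(** Between different classes, a path advances cyclically through surviving vertices until the
    target is within distance [k]. Only class [2 * k] can have several vertices; two of these are
    joined through a surviving vertex outside it. *)
Lemma circular_strong k n (D : rel 'I_n) :
  (2 * k).+1 <= n -> has_circular_arcs k D -> k_strong k D.
Proof.
move=> le_kn circD; split=> [|S ltSk]; first by lia.
set N := (2 * k).+1.
pose rep c (ltc : c < N) : 'I_n := Ordinal (leq_trans ltc le_kn).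
pose e := fun a b => [&& D a b, a \notin S & b \notin S].
have dist_conn d (x y : 'I_n) : x \notin S -> y \notin S ->
    blowup_class k x != blowup_class k y ->
    (blowup_class k y + N - blowup_class k x) %% N <= d -> connect e x y.
  elim: d x => [|d IH] x xS yS neq_xy.
    move: neq_xy; rewrite /blowup_class => neq_xy.
    have [lt_yx|le_xy] := ltnP (minn y (2 * k)) (minn x (2 * k)).
      by rewrite modn_small; lia.
    by rewrite addnC -addnBA // modnDl modn_small; lia.
  move=> le_d.
  have [near|far] := leqP ((blowup_class k y + N - blowup_class k x) %% N) k.
    apply: connect1; rewrite /e xS yS circD //= /circular_arc near !andbT.
    have := neq_xy; rewrite /blowup_class -/N => neq'.
    have [lt_yx|le_xy] := ltnP (minn y (2 * k)) (minn x (2 * k)).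
      by rewrite modn_small /N; lia.
    by rewrite addnC -addnBA // modnDl modn_small /N; lia.
  have ltmN i : (blowup_class k x + i.+1) %% N < N by rewrite ltn_mod.
  (* One vertex in each of the [k] classes following that of [x]. Fewer than [k] vertices are
     deleted, so one remains, and moving there shortens the distance to [y] without overshooting. *)
  pose f (i : 'I_k) : 'I_n := rep _ (ltmN i).
  have injf : injective f.
    move=> i j /(congr1 val) /= /eqP; rewrite eqn_modDl.
    rewrite !modn_small ?ltnS; try by have := ltn_ord i; have := ltn_ord j; lia.
    by move=> /eqP [] /val_inj.
  have /exists_inP [i _ fiS] : [exists i in 'I_k, f i \notin S].
    apply: contraTT ltSk => /exists_inPn fS; rewrite -leqNgt.
    rewrite -[X in X <= _](card_ord k) -(card_imset _ injf).
    apply: subset_leq_card; apply/subsetP => _ /imsetP [i _ ->].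
    by have := fS i isT; rewrite negbK.
  have cfi : blowup_class k (f i) = (blowup_class k x + i.+1) %% N.
    by rewrite /blowup_class /f /=; apply/minn_idPl; rewrite -ltnS ltn_mod.
  have cx : blowup_class k x < N by rewrite /blowup_class /N; lia.
  have cy : blowup_class k y < N by rewrite /blowup_class /N; lia.
  move: (ltn_ord i) => ltik.
  have cases : (blowup_class k x + i.+1) %% N =
      if blowup_class k x + i.+1 < N then blowup_class k x + i.+1
      else blowup_class k x + i.+1 - N.
    case: ltnP => h; first by rewrite modn_small.
    by rewrite -{1}(subnK h) modnDr modn_small // /N; rewrite /N in cx; lia.
  have dE c d' : c < N -> d' < N ->
      (d' + N - c) %% N = if c <= d' then d' - c else d' + N - c.
    move=> cN dN; case: leqP => cd.
      by rewrite addnC -addnBA // modnDl modn_small //; lia.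
    by rewrite modn_small //; lia.
  move: far le_d; rewrite dE // => far le_d.
  have neq1 : blowup_class k x != blowup_class k (f i).
    by rewrite cfi cases /N; rewrite /N in far le_d cx cy; case: ifP; lia.
  have neq2 : blowup_class k (f i) != blowup_class k y.
    rewrite cfi cases /N; rewrite /N in far le_d cx cy; move: far le_d.
    by case: ifP; case: ifP; lia.
  apply: (@connect_trans _ _ (f i)); last first.
    apply: IH => //; rewrite dE ?cfi ?ltn_mod // cases /N.
    rewrite /N in far le_d cx cy; move: far le_d.
    by case: (ltnP (blowup_class k x + i.+1) (2 * k).+1); case: ifP; case: ifP; lia.
  apply: connect1; rewrite /e xS fiS circD //= /circular_arc -/N dE ?cfi ?ltn_mod //.
  rewrite cases /N; rewrite /N in far le_d cx cy.
  case: (ltnP (blowup_class k x + i.+1) (2 * k).+1); case: ifP; lia.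
have conn_neq x y : x \notin S -> y \notin S ->
    blowup_class k x != blowup_class k y -> connect e x y.
  by move=> xS yS neq; apply: dist_conn (leqnn _).
move=> x y xS yS.
have [eq_xy|] := eqVneq (blowup_class k x) (blowup_class k y); last exact: conn_neq.
have [->|neq_xy] := eqVneq x y; first exact: connect0.
have cx : blowup_class k x = 2 * k.
  apply/eqP; rewrite eqn_leq {1}/blowup_class geq_minr /=.
  by move: eq_xy neq_xy; rewrite -val_eqE /blowup_class /=; lia.
pose f (i : 'I_(2 * k)) : 'I_n := widen_ord (ltnW le_kn) i.
have injf : injective f by move=> i j /(congr1 val) /= /val_inj.
have /exists_inP [i _ fiS] : [exists i in 'I_(2 * k), f i \notin S].
  have lt2 : #|S| < 2 * k by lia.
  apply: contraTT lt2 => /exists_inPn fS; rewrite -leqNgt.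
  rewrite -[X in X <= _](card_ord (2 * k)) -(card_imset _ injf).
  apply: subset_leq_card; apply/subsetP => _ /imsetP [i _ ->].
  by have := fS i isT; rewrite negbK.
have cfi : blowup_class k (f i) != 2 * k.
  by have := ltn_ord i; rewrite /blowup_class /f /=; lia.
apply: (@connect_trans _ _ (f i)); apply: conn_neq => //.
  by rewrite cx eq_sym.
by rewrite -eq_xy cx.
Qed.

(** Vertices are treated in increasing order. The set used for vertex [i] contains no smaller
    vertex, so the arcs corrected before are not disturbed. *)
Lemma circular_inversions k n (T : rel 'I_n) :
  is_tournament T -> (2 * k).+1 <= n ->
  exists Xs, size Xs = 2 * k /\ has_circular_arcs k (invert_seq T Xs).
Proof.
move=> tT le_kn.
have step i : i <= 2 * k -> exists Xs, size Xs = i /\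
    forall x y : 'I_n, x < y -> x < i ->
      invert_seq T Xs x y = circular_arc k (blowup_class k x) (blowup_class k y).
  elim: i => [|i IH] lei; first by exists [::].
  have [Xs [sXs okXs]] := IH (ltnW lei).
  set D := invert_seq T Xs in okXs.
  have ltin : i < n by lia.
  pose v := Ordinal ltin.
  pose X := v |: [set y : 'I_n | (i < y) &&
     (D v y != circular_arc k (blowup_class k v) (blowup_class k y))].
  exists (rcons Xs X); split=> [|x y lt_xy lt_xi]; first by rewrite size_rcons sXs.
  rewrite /invert_seq foldl_rcons -/(invert_seq T Xs) -/D /invert.
  have [lt_xi'|le_ix] := ltnP x i.
    have xX : (x \in X) = false.
      by rewrite !inE -val_eqE /=; apply/negbTE; lia.
    rewrite xX andFb; exact: okXs.
  have -> : x = v by apply: val_inj => /=; lia.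
  have lt_iy : i < y by lia.
  have neq_yv : (y == v) = false by apply/negbTE; rewrite -val_eqE /=; lia.
  rewrite /X !inE eqxx /= lt_iy neq_yv /=.
  have [//|neqD] := eqVneq (D v y) _.
  have [_ /(_ v y)] := invert_seq_tournament Xs tT.
  rewrite eq_sym neq_yv -/D => /(_ isT); move: neqD.
  by case: (D v y); case: (D y v); case: circular_arc.
have [Xs [sXs okXs]] := step _ (leqnn _).
exists Xs; split=> // x y neq_xy.
have [_ asymD] := invert_seq_tournament Xs tT.
have [lt_xy|lt_yx|eq_xy] := ltngtP x y.
(* Distinct classes force the smaller index below [2 * k], where the arcs have been corrected. *)
- by apply: okXs => //; move: neq_xy; rewrite /blowup_class; lia.
- have lt_yk : y < 2 * k by move: neq_xy; rewrite /blowup_class; lia.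
  rewrite [RHS]circular_arc_asym ?geq_minr 1?eq_sym // -okXs //.
  have /asymD : x != y by rewrite -val_eqE /=; lia.
  by case: (invert_seq T Xs x y); case: (invert_seq T Xs y x).
- by move: neq_xy; rewrite /blowup_class eq_xy eqxx.
Qed.

Lemma k_strong_inversions k n (T : rel 'I_n) :
  is_tournament T -> (2 * k).+1 <= n ->
  exists Xs, size Xs = 2 * k /\ k_strong k (invert_seq T Xs).
Proof.
move=> tT le_kn; have [Xs [sXs circ]] := circular_inversions tT le_kn.
by exists Xs; split=> //; apply: circular_strong.
Qed.

(* Deleting the tails, or the heads, of the fewer than [k] arcs of a cut
   disconnects what is left of the two sides. *)
Lemma k_strong_arc_strong k n (D : rel 'I_n) :
  (2 * k).+1 <= n -> k_strong k D -> k_arc_strong k D.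
Proof.
move=> le_kn [_ strD] V1 V1n0 V2n0; rewrite leqNgt; apply/negP.
set F := [set p | _] => ltFk.
have sep (S : {set 'I_n}) x y : #|S| < k -> x \in V1 :\: S -> y \in (~: V1) :\: S ->
    exists a b : 'I_n, [/\ (a, b) \in F, a \notin S & b \notin S].
  move=> ltSk /setDP [xV xS] /setDP [yV yS].
  have := strD S ltSk x y xS yS.
  case/connectP => p; elim: p x xV xS => [|b p IH] a aV aS /=.
    by move=> _ eq; move: yV; rewrite eq inE aV.
  case/andP => /and3P [Dab _ bS] pth lst.
  have [bV|bV] := boolP (b \in V1); first exact: (IH b).
  by exists a, b; split=> //; rewrite inE /= aV Dab inE bV.
pose tl := [set p.1 | p in F]; pose hd := [set p.2 | p in F].
have ltt : #|tl| < k by apply: leq_ltn_trans (leq_imset_card _ _) ltFk.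
have lth : #|hd| < k by apply: leq_ltn_trans (leq_imset_card _ _) ltFk.
(* Tails lie in [V1], so deleting them spares [~: V1]; a vertex of [V1] that survived would yield a
   cut arc whose tail is not deleted. *)
have subt : V1 \subset tl.
  apply/subsetPn => -[x xV xt]; have [y yV] := set0Pn _ V2n0.
  have yt : y \notin tl.
    by apply/imsetP => -[p]; rewrite inE => /and3P [h _ _] eq; move: yV; rewrite inE eq h.
  have [||a [b [Fab /imsetP at_ _]]] := sep tl x y ltt; rewrite ?inE ?xV ?xt ?yt //.
    by rewrite inE in yV.
  by apply: at_; exists (a, b).
have subh : ~: V1 \subset hd.
  apply/subsetPn => -[y yV yh]; have [x xV] := set0Pn _ V1n0.
  have xh : x \notin hd.
    by apply/imsetP => -[p]; rewrite inE => /and3P [_ h _] eq; move: h; rewrite -eq inE xV.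
  have [||a [b [Fab _ /imsetP bt]]] := sep hd x y lth; rewrite ?inE ?xV ?xh ?yh //.
    by rewrite inE in yV; rewrite yV.
  by apply: bt; exists (a, b).
(* Both sides of the cut now have fewer than [k] vertices, too few for [n]. *)
have := leq_add (subset_leq_card subt) (subset_leq_card subh).
by rewrite cardsC card_ord; move: #|tl| #|hd| ltt lth; lia.
Qed.

(** * Counting regular tournaments *)

From mathcomp Require Import all_order all_algebra cyclic complex boolp reals Rstruct.
From mathcomp Require Import ring lra.

Import Order.TTheory GRing.Theory Num.Theory.

(** Only the values of [g] at pairs with [x < y] matter. Every tournament therefore has the same
    number of codes, and proportions can be taken among all [2 ^ (n * n)] functions. *)
Definition tournament_of n (g : {ffun 'I_n * 'I_n -> bool}) : rel 'I_n :=
  fun x y => if x < y then g (x, y) else if y < x then ~~ g (y, x) else false.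

Definition outdeg n (D : rel 'I_n) (x : 'I_n) := #|[pred y | D x y]|.
Definition indeg n (D : rel 'I_n) (x : 'I_n) := #|[pred y | D y x]|.
Definition regular n (D : rel 'I_n) := [forall x, outdeg D x == indeg D x].

Lemma not_uniq_perm (T : eqType) (r : seq T) :
  ~~ uniq r -> exists a r', perm_eq r [:: a, a & r'].
Proof.
elim: r => //= x r IH; rewrite negb_and negbK => /orP [xr|/IH [a [r' rE]]].
  by exists x, (rem x r); rewrite perm_cons perm_to_rem.
exists a, (x :: r'); apply: (@perm_trans _ (x :: [:: a, a & r'])).
  by rewrite perm_cons.
exact/permPl/(perm_catCA [:: x] [:: a; a] r').
Qed.

(** * Fourier inversion with roots of unity *)

Section Fourier.
Local Open Scope ring_scope.
Variable C : numClosedFieldType.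

(** A double root of ['X^N - 1] would also be a root of its derivative, hence 0, which is not a
    root. So there are [N] distinct roots of unity, and [has_prim_root] applies. *)
Lemma prim_root_exists N : (0 < N)%N -> exists z : C, N.-primitive_root z.
Proof.
move=> N0; pose p : {poly C} := 'X^N - 1; have [r Dp] := closed_field_poly_normal p.
rewrite (monicP _) ?monicXnsubC // scale1r in Dp.
have rN1 : all N.-unity_root r by apply/allP=> z; rewrite -root_prod_XsubC -Dp.
have sz_r : (N < (size r).+1)%N.
  by rewrite -(size_prod_XsubC r id) -Dp size_XnsubC.
have [|z] := hasP (has_prim_root N0 rN1 _ sz_r); last by exists z.
apply: contraT => /not_uniq_perm [a [r' rE]].
have : root p^`() a.
  rewrite Dp (perm_big _ rE) !big_cons rootE !derivM derivXsubC !hornerE.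
  by rewrite subrr !(mul0r, mulr0, addr0).
have /allP/(_ a) := rN1; rewrite (perm_mem rE) mem_head => /(_ isT).
rewrite unity_rootE => /eqP aN.
rewrite /p derivB derivXn derivC subr0 rootE hornerMn hornerXn mulrn_eq0.
rewrite (gtn_eqF N0) /= expf_eq0 => /andP [_ /eqP a0].
by move/eqP: aN; rewrite a0 expr0n (gtn_eqF N0) eq_sym oner_eq0.
Qed.

Lemma sum_unity_root N (t : C) : t ^+ N = 1 ->
  \sum_(i < N) t ^+ i = if t == 1 then N%:R else 0.
Proof.
move=> tN; have [->|t1] := eqVneq t 1.
  by under eq_bigr do rewrite expr1n; rewrite sumr_const card_ord.
have := subrX1 t N; rewrite tN subrr => /esym/eqP.
by rewrite mulf_eq0 subr_eq0 (negPf t1) => /eqP.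
Qed.

Variables (n : nat).
Implicit Types (g : {ffun 'I_n * 'I_n -> bool}) (u : 'I_n -> C).

(** Value at the tail divided by value at the head, counted once per unordered pair. *)
Definition arc_weight u (p : 'I_n * 'I_n) (b : bool) : C :=
  if (p.1 < p.2)%N then (if b then u p.1 / u p.2 else u p.2 / u p.1) else 1.

Lemma prod_arc_weight g u :
  \prod_p arc_weight u p (g p) =
  \prod_x (u x ^+ outdeg (tournament_of g) x / u x ^+ indeg (tournament_of g) x).
Proof.
(* The factor that [x] receives from its pair with [y]; swapping coordinates later joins [A x y] and
   [A y x] into one arc weight. *)
pose A x y := if tournament_of g x y then u x else
              if tournament_of g y x then (u x)^-1 else 1.
transitivity (\prod_x \prod_y A x y); last first.
  apply: eq_bigr => x _.
  rewrite (bigID (fun y => tournament_of g x y)) /=; congr (_ * _).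
    under eq_bigr => y xy do rewrite /A xy.
    by rewrite prodr_const.
  rewrite (bigID (fun y => tournament_of g y x)) /= [X in _ * X]big1 ?mulr1; last first.
    by move=> y /andP [/negbTE xy /negbTE yx]; rewrite /A xy yx.
  under eq_bigr => y /andP [/negbTE xy yx] do rewrite /A xy yx.
  rewrite prodr_const exprVn; congr (_ ^- _); apply: eq_card => y.
  by rewrite [LHS]unfold_in inE /tournament_of; case: (ltngtP x y) => /= _; rewrite ?negbK ?andbb.
rewrite pair_big /= (bigID (fun p : 'I_n * 'I_n => (p.1 < p.2)%N)) /=.
rewrite [X in _ * X]big1 ?mulr1; last by move=> p /negbTE h; rewrite /arc_weight h.
rewrite [RHS](bigID (fun p : 'I_n * 'I_n => (p.1 < p.2)%N)) /=.
rewrite [X in _ * X](bigID (fun p : 'I_n * 'I_n => (p.2 < p.1)%N)) /=.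
rewrite [X in _ * (_ * X)]big1 ?mulr1; last first.
  by move=> p; rewrite /A /tournament_of; case: ltngtP.
rewrite [X in _ * X](reindex_inj (h := fun p : 'I_n * 'I_n => (p.2, p.1))); last first.
  by move=> [a b] [c d] [-> ->].
rewrite [X in _ * X](eq_bigl (fun p : 'I_n * 'I_n => (p.1 < p.2)%N)); last first.
  by move=> p /=; case: ltngtP.
rewrite -big_split /=; apply: eq_bigr => -[x y] /= xy.
rewrite /arc_weight /A /tournament_of /= xy ltnNge (ltnW xy) /=.
by case: (g _) => //=; rewrite mulrC.
Qed.

Lemma sum_prod_arc_weight u :
  \sum_(g : {ffun 'I_n * 'I_n -> bool}) \prod_p arc_weight u p (g p) =
  \prod_(p : 'I_n * 'I_n)
     (if (p.1 < p.2)%N then u p.1 / u p.2 + u p.2 / u p.1 else 2).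
Proof.
rewrite -(bigA_distr_bigA (fun p b => arc_weight u p b)).
apply: eq_bigr => p _; rewrite big_bool /arc_weight.
by case: ifP => // _; ring.
Qed.

(** Exchanging the sums, each [g] contributes a product of geometric sums: [N ^ n] when regular, and
    otherwise something nonnegative, since degrees may still agree modulo [N]. Hence an
    inequality. *)
Lemma regular_count_le N (z : C) : z ^+ N = 1 -> z != 0 ->
  (#|[pred g : {ffun 'I_n * 'I_n -> bool} | regular (tournament_of g)]| * N ^ n)%:R <=
  \sum_(a : {ffun 'I_n -> 'I_N}) \prod_(p : 'I_n * 'I_n)
     (if (p.1 < p.2)%N then z ^+ a p.1 / z ^+ a p.2 + z ^+ a p.2 / z ^+ a p.1
      else 2).
Proof.
move=> zN z0.
under eq_bigr => a _ do
  rewrite -(sum_prod_arc_weight (fun x => z ^+ a x)).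
rewrite exchange_big /=.
pose t g x := z ^+ outdeg (tournament_of g) x / z ^+ indeg (tournament_of g) x.
have inner g : \sum_(a : {ffun 'I_n -> 'I_N})
    \prod_p arc_weight (fun x => z ^+ a x) p (g p) =
    \prod_x (if t g x == 1 then N%:R else 0).
  pose F x (i : 'I_N) := t g x ^+ i.
  transitivity (\sum_(a : {ffun 'I_n -> 'I_N}) \prod_x F x (a x)).
    apply: eq_bigr => a _; rewrite prod_arc_weight; apply: eq_bigr => x _.
    rewrite /F /t expr_div_n -!exprM; congr (_ / _); congr (_ ^+ _); exact: mulnC.
  rewrite -bigA_distr_bigA; apply: eq_bigr => x _.
  apply: sum_unity_root; rewrite /t expr_div_n -!exprM ![(_ * N)%N]mulnC !exprM zN.
  by rewrite !expr1n divr1.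
rewrite (eq_bigr _ (fun g _ => inner g)).
rewrite (bigID (fun g => regular (tournament_of g))) /=.
rewrite (eq_bigr (fun=> N%:R ^+ n)); last first.
  move=> g /forallP rg; rewrite (eq_bigr (fun=> N%:R)) ?prodr_const ?card_ord //.
  by move=> x _; rewrite /t (eqP (rg x)) divff ?eqxx // expf_neq0.
rewrite sumr_const natrM natrX mulr_natl lerDl.
by apply: sumr_ge0 => g _; apply: prodr_ge0 => x _; case: ifP => // _; rewrite ler0n.
Qed.

(* Expand [(1 + v) ^+ (2 * m) / v ^+ m], where [v = z ^+ (2 * i) / t]. *)
Lemma sum_root_binomial N m (z t : C) :
  N.-primitive_root z -> (4 * m < N)%N -> t != 0 ->
  \sum_(i < N) (2 + z ^+ (2 * i) / t + t / z ^+ (2 * i)) ^+ m =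
    (N * 'C(2 * m, m))%:R.
Proof.
move=> pz mN t0; have zN := prim_expr_order pz.
have N0 : (0 < N)%N by apply: leq_ltn_trans mN.
have z0 : z != 0.
  by apply/eqP => z0; move/eqP: zN; rewrite z0 expr0n -(prednK N0) eq_sym oner_eq0.
have zX0 e : z ^+ e != 0 by rewrite expf_neq0.
transitivity (\sum_(i < N) \sum_(j < (2 * m).+1)
    (t ^+ m / t ^+ j *+ 'C(2 * m, j)) * (z ^+ (2 * j) / z ^+ (2 * m)) ^+ i).
  apply: eq_bigr => i _; set v := z ^+ (2 * i).
  have v0 : v != 0 by apply: zX0.
  have -> : 2 + v / t + t / v = (1 + v / t) ^+ 2 * (t / v) by field; rewrite t0 v0.
  rewrite exprMn -exprM exprDn mulr_suml; apply: eq_bigr => j _.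
  rewrite expr1n mul1r -!mulrnAl !expr_div_n mulrnAl -mulrnAl -mulrnAr.
  rewrite -mulr_natr -[_ *+ 'C(_, _) in RHS]mulr_natr.
  have -> : v ^+ j = (z ^+ (2 * j)) ^+ i by rewrite /v -!exprM; congr (_ ^+ _); lia.
  have -> : v ^+ m = (z ^+ (2 * m)) ^+ i by rewrite /v -!exprM; congr (_ ^+ _); lia.
  by field; rewrite !expf_neq0.
rewrite exchange_big /=.
have mlt : (m < (2 * m).+1)%N by lia.
rewrite (bigD1 (Ordinal mlt)) //= [X in _ + X]big1 ?addr0.
  rewrite -mulr_sumr !divff ?expf_neq0 //.
  under eq_bigr do rewrite expr1n.
  by rewrite sumr_const card_ord mulr_natl -mulrnA mulnC.
(* For [j] other than [m], the exponents [2 * j] and [2 * m] are distinct and at most [4 * m < N],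
   so the root is not 1 and its powers sum to 0. *)
move=> j jm; rewrite -mulr_sumr sum_unity_root; last first.
  by rewrite expr_div_n -!exprM ![(_ * N)%N]mulnC !exprM zN !expr1n divr1.
case: eqP => [/(canRL (mulfVK (zX0 _)))|]; last by rewrite mulr0.
rewrite mul1r => /eqP; rewrite (eq_prim_root_expr pz) !modn_small.
- by move=> /eqP e; case/eqP: jm; apply: val_inj => /=; lia.
- by lia.
- by have := ltn_ord j; lia.
Qed.
End Fourier.

(** * Real coordinates of the roots of unity *)

Section CirclePoints.
Local Open Scope ring_scope.
Variable R : rcfType.
Local Open Scope complex_scope.
Local Notation Re := (@complex.Re R).
Local Notation Im := (@complex.Im R).

Lemma unity_root_ReIm N (z : R[i]) : (0 < N)%N -> z ^+ N = 1 ->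
  Re z ^+ 2 + Im z ^+ 2 = 1.
Proof.
move=> N0 zN.
have /eqP : `|z| ^+ N = 1 by rewrite -normrX zN normr1.
rewrite pexpr_eq1 ?normr_ge0 // => /eqP z1.
by apply: (@complexI R); rewrite add_Re2_Im2 z1 expr1n.
Qed.

Lemma unit_complexV (z : R[i]) : Re z ^+ 2 + Im z ^+ 2 = 1 -> z^-1 = z^*%C.
Proof.
move=> z1; have zz : z * z^*%C = 1.
  by rewrite -sqr_normc -add_Re2_Im2 z1.
have z0 : z != 0 by apply/eqP => z0; move/eqP: zz; rewrite z0 mul0r eq_sym oner_eq0.
by apply: (mulfI z0); rewrite divff.
Qed.

(** Both sides are twice the cosine of the difference of the two angles. *)
Lemma unit_complex_divD (z w : R[i]) :
  Re z ^+ 2 + Im z ^+ 2 = 1 -> Re w ^+ 2 + Im w ^+ 2 = 1 ->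
  z / w + w / z = (2 * (Re z * Re w + Im z * Im w))%:C.
Proof.
move=> /unit_complexV -> /unit_complexV ->; case: z w => [a b] [c d] /=.
by apply/eqP; rewrite eq_complex /=; apply/andP; split; apply/eqP; ring.
Qed.

(** Here [s i] and [t i] are the cosine and sine of the angle of [z ^+ i], so [s i ^+ 2 - t i ^+ 2]
    and [2 * s i * t i] are those of the doubled angle. The last item is the mean of the [2 * m]-th
    power of a cosine with shifted angle. *)
Lemma circle_points N : (0 < N)%N -> exists s t : 'I_N -> R,
  [/\ forall i, s i ^+ 2 + t i ^+ 2 = 1,
      forall n,
        (#|[pred g : {ffun 'I_n * 'I_n -> bool} | regular (tournament_of g)]| * N ^ n)%:R
        <= 2 ^+ (n * n) * \sum_(a : {ffun 'I_n -> 'I_N})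
             \prod_(p : 'I_n * 'I_n | (p.1 < p.2)%N)
                (s (a p.1) * s (a p.2) + t (a p.1) * t (a p.2))
    & forall m (al be : R), (4 * m < N)%N -> al ^+ 2 + be ^+ 2 = 1 ->
        \sum_(i < N) ((1 + (al * (s i ^+ 2 - t i ^+ 2) + be * (2 * s i * t i))) / 2) ^+ m
        = N%:R * ('C(2 * m, m)%:R / 4 ^+ m)].
Proof.
move=> N0; have [z pz] := prim_root_exists R[i] N0.
have zN := prim_expr_order pz.
have z0 : z != 0.
  by apply/eqP => z0; move/eqP: zN; rewrite z0 expr0n -(prednK N0) eq_sym oner_eq0.
have zi1 i : Re (z ^+ i) ^+ 2 + Im (z ^+ i) ^+ 2 = 1.
  by apply: (unity_root_ReIm N0); rewrite -exprM mulnC exprM zN expr1n.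
exists (fun i => Re (z ^+ i)), (fun i => Im (z ^+ i)); split=> [i|n|m al be mN ab1].
- exact: zi1.
- rewrite -lecR rmorph_nat; set rhs := (X in _ <= X).
  suff -> : rhs = \sum_(a : {ffun 'I_n -> 'I_N}) \prod_(p : 'I_n * 'I_n)
     (if (p.1 < p.2)%N then z ^+ a p.1 / z ^+ a p.2 + z ^+ a p.2 / z ^+ a p.1
      else 2) by exact: regular_count_le.
  rewrite /rhs rmorphM rmorph_sum mulr_sumr; apply: eq_bigr => a _.
  (* Each ordered pair takes one factor 2: that of twice a cosine if [p.1 < p.2], the bare 2
     otherwise. *)
  have -> : (n * n)%N = #|{: 'I_n * 'I_n}| by rewrite card_prod card_ord.
  rewrite -prodr_const rmorph_prod rmorph_prod [X in _ * X]big_mkcond -big_split /=.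
  apply: eq_bigr => p _; case: ifP => _; last by rewrite mulr1 rmorph_nat.
  by rewrite unit_complex_divD // -rmorphM.
- apply: (@complexI R); rewrite rmorph_sum rmorphM rmorph_nat.
  pose w := al +i* be; have w0 : w != 0.
    apply/eqP => /eqP; rewrite eq_complex /= => /andP [/eqP a0 /eqP b0].
    by move/eqP: ab1; rewrite a0 b0 !expr0n addr0 eq_sym oner_eq0.
  have := sum_root_binomial pz mN w0; rewrite natrM => /(congr1 (fun x => x / 4 ^+ m)).
  rewrite -mulrA mulr_suml rmorphM rmorph_nat fmorphV rmorphXn rmorph_nat => <-.
  apply: eq_bigr => i _; rewrite -expr_div_n rmorphXn; congr (_ ^+ m).
  have -> : z ^+ (2 * i) = (z ^+ i) ^+ 2 by rewrite -exprM mulnC.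
  have := zi1 (2 * i)%N; have -> : z ^+ (2 * i) = (z ^+ i) ^+ 2 by rewrite -exprM mulnC.
  move: (z ^+ i) => v v1.
  rewrite -addrA unit_complex_divD //; case: v v1 => a b _ /=.
  have -> : (2 : R[i]) = 2%:C by rewrite rmorph_nat.
  have -> : (4 : R[i]) = 4%:C by rewrite rmorph_nat.
  by rewrite -rmorphD -fmorphV -rmorphM; congr (_%:C); field.
Qed.
End CirclePoints.

(** Induction on the ratio of consecutive central binomials. The constant 3 is good enough because
    [3 * m] is about [6 / 5 * n] for [m] near [2 / 5 * n], which exceeds [n]. *)
Lemma central_bin_bound m : 'C(2 * m, m) ^ 2 * (3 * m).+1 <= 16 ^ m.
Proof.
elim: m => [|m IH]; first by rewrite bin0.
have rec : m.+1 * 'C(2 * m.+1, m.+1) = 2 * (2 * m).+1 * 'C(2 * m, m).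
  have sym : 'C((2 * m).+1, m) = 'C((2 * m).+1, m.+1).
    by rewrite -bin_sub; [congr 'C(_, _); lia | lia].
  have -> : 2 * m.+1 = (2 * m).+2 by lia.
  have := mul_bin_diag (2 * m).+2 m; have := mul_bin_diag (2 * m).+1 m.
  by rewrite /= sym; lia.
have : m.+1 ^ 2 * ('C(2 * m.+1, m.+1) ^ 2 * (3 * m.+1).+1) <= m.+1 ^ 2 * 16 ^ m.+1.
  rewrite mulnA -expnMn rec !expnMn.
  have le_coef : 2 ^ 2 * (2 * m).+1 ^ 2 * (3 * m.+1).+1 <= 16 * m.+1 ^ 2 * (3 * m).+1.
    by rewrite -!mulnn; nia.
  rewrite mulnAC; apply: leq_trans (leq_mul le_coef (leqnn _)) _.
  rewrite -mulnA [(3 * m).+1 * _]mulnC; apply: leq_trans (leq_mul (leqnn _) IH) _.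
  by rewrite [16 * _]mulnC -mulnA -expnS.
by rewrite leq_pmul2l // expn_gt0.
Qed.

(** * The exponential function, axiomatically *)

Section ExponentialFunction.
Local Open Scope ring_scope.
Variables (R : realType) (f : R -> R).

(** All estimates below rest on these two properties alone; they are finally applied to the
    exponential of the standard reals. *)
Definition is_exponential :=
  (forall x y, f (x + y) = f x * f y) /\ (forall x, 1 + x <= f x).

Hypothesis f_exp : is_exponential.

Lemma exponentialD x y : f (x + y) = f x * f y.
Proof. exact: f_exp.1. Qed.

Lemma exponential_ge1Dx x : 1 + x <= f x.
Proof. exact: f_exp.2. Qed.

Lemma exponential0 : f 0 = 1.
Proof.
have f0 : f 0 != 0 by have := exponential_ge1Dx 0; rewrite addr0; case: eqP => // ->; lra.
by apply: (mulfI f0); rewrite -exponentialD addr0 mulr1.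
Qed.

Lemma exponential_gt0 x : 0 < f x.
Proof.
have fx : f x = f (x / 2) ^+ 2 by rewrite expr2 -exponentialD; congr f; field.
rewrite lt0r {2}fx sqr_ge0 andbT; apply/eqP => fx0.
have := exponentialD x (- x); rewrite subrr exponential0 fx0 mul0r => /eqP.
by rewrite oner_eq0.
Qed.

Lemma exponential_ge0 x : 0 <= f x.
Proof. exact: ltW (exponential_gt0 x). Qed.

Lemma exponentialN x : f (- x) = (f x)^-1.
Proof.
have fx0 : f x != 0 by rewrite gt_eqF ?exponential_gt0.
by apply: (mulfI fx0); rewrite -exponentialD subrr exponential0 divff.
Qed.

Lemma ler_exponential : {mono f : x y / x <= y}.
Proof.
apply: le_mono => x y; rewrite -subr_gt0 => xy.
rewrite -[y](subrK x) exponentialD ltr_pMl ?exponential_gt0 //.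
by have := exponential_ge1Dx (y - x); lra.
Qed.

Lemma exponential_le1 x : (f x <= 1) = (x <= 0).
Proof. by rewrite -exponential0 ler_exponential. Qed.

Lemma exponentialM_natl n x : f (n%:R * x) = f x ^+ n.
Proof.
elim: n => [|n IH]; first by rewrite mul0r exponential0 expr0.
by rewrite -natr1 mulrDl mul1r exponentialD IH exprSr.
Qed.

Lemma exponential_sum (I : finType) (F : I -> R) :
  f (\sum_i F i) = \prod_i f (F i).
Proof.
by apply: (big_morph f); [exact: exponentialD | exact: exponential0].
Qed.
End ExponentialFunction.

(** * Estimating the mean of the cosine product *)

Section RegularTournamentCount.
Local Open Scope ring_scope.
Variables (R : realType) (expR : R -> R).
Hypothesis expR_exp : is_exponential expR.

Let expRD := exponentialD expR_exp.
Let expR_ge1Dx := exponential_ge1Dx expR_exp.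
Let expR0 := exponential0 expR_exp.
Let expR_gt0 := exponential_gt0 expR_exp.
Let expR_ge0 := exponential_ge0 expR_exp.
Let expRN := exponentialN expR_exp.
Let ler_expR := ler_exponential expR_exp.
Let expR_le1 := exponential_le1 expR_exp.
Let expRM_natl := exponentialM_natl expR_exp.
Let expR_sum := exponential_sum expR_exp.

(** The fourth power of the product is the product of [c p ^+ 2] over all ordered pairs, the
    diagonal giving 1. These squares have mean [1 + Y / (2 * n ^ 2)]; AM-GM and [1 + x <= expR x]
    finish. *)
Lemma prod_cos_le n (s t : 'I_n -> R) :
  (0 < n)%N -> (forall x, s x ^+ 2 + t x ^+ 2 = 1) ->
  \prod_(p : 'I_n * 'I_n | (p.1 < p.2)%N) (s p.1 * s p.2 + t p.1 * t p.2) <=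
  expR (((\sum_x (s x ^+ 2 - t x ^+ 2)) ^+ 2 + (\sum_x 2 * s x * t x) ^+ 2
         - n%:R ^+ 2) / 8).
Proof.
move=> n0 st1; set X := \prod_(p | _) _.
set A := \sum_x _; set B := \sum_x (2 * _ * _).
pose c (p : 'I_n * 'I_n) := s p.1 * s p.2 + t p.1 * t p.2.
have c2E p : c p ^+ 2 = (1 + (s p.1 ^+ 2 - t p.1 ^+ 2) * (s p.2 ^+ 2 - t p.2 ^+ 2)
                           + (2 * s p.1 * t p.1) * (2 * s p.2 * t p.2)) / 2.
  have e1 : (s p.1 ^+ 2 + t p.1 ^+ 2) * (s p.2 ^+ 2 + t p.2 ^+ 2) = 1 by rewrite !st1 mulr1.
  by rewrite -[X in (X + _ + _) / _]e1 /c; field.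
have X4 : X ^+ 4 = \prod_p c p ^+ 2.
  rewrite (bigID (fun p : 'I_n * 'I_n => (p.1 < p.2)%N)) /= prodrXl -/X.
  rewrite [X in _ * X](bigID (fun p : 'I_n * 'I_n => (p.2 < p.1)%N)) /=.
  rewrite [X in _ * (_ * X)]big1 ?mulr1; last first.
    move=> [x y] /=; rewrite -!leqNgt => /andP [yx xy].
    have -> : x = y by apply: val_inj; apply/eqP; rewrite eqn_leq xy yx.
    by rewrite /c /= -!expr2 st1 expr1n.
  rewrite [X in _ * X](reindex_inj (h := fun p : 'I_n * 'I_n => (p.2, p.1))); last first.
    by move=> [a b] [d e] [-> ->].
  rewrite [X in _ * X](eq_bigl (fun p : 'I_n * 'I_n => (p.1 < p.2)%N)); last first.
    by move=> p /=; case: ltngtP.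
  rewrite prodrXl /= [X in _ = _ * X ^+ _](_ : _ = X) -?exprD //.
  by apply: eq_bigr => p _; rewrite /c /= [s p.2 * _]mulrC [t p.2 * _]mulrC.
have sum_c2 : \sum_p c p ^+ 2 = (n%:R ^+ 2 + A ^+ 2 + B ^+ 2) / 2.
  under eq_bigr do rewrite c2E.
  rewrite -mulr_suml !big_split /= sumr_const card_prod card_ord; congr ((_ + _ + _) / _).
  - by rewrite natrM expr2.
  - rewrite expr2 /A big_distrlr pair_big /=; exact: eq_bigr.
  - rewrite expr2 /B big_distrlr pair_big /=; exact: eq_bigr.
have nR0 : (n%:R : R) != 0 by rewrite pnatr_eq0 -lt0n.
set Y := (A ^+ 2 + B ^+ 2 - n%:R ^+ 2).
have X4le : X ^+ 4 <= expR (Y / 8) ^+ 4.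
  rewrite X4 -expRM_natl.
  have [AGM _] := leif_AGM (A := predT) (E := fun p : 'I_n * 'I_n => c p ^+ 2)
    (fun p _ => sqr_ge0 _).
  apply: le_trans AGM _; rewrite card_prod card_ord -[\sum_(i in _) _]/(\sum_i c i ^+ 2) sum_c2.
  have -> : 4 * (Y / 8) = (n * n)%:R * (Y / (2 * n%:R ^+ 2)) by rewrite natrM; field.
  rewrite expRM_natl; apply: lerXn2r.
  - rewrite nnegrE; apply: divr_ge0; rewrite ?ler0n //.
    by rewrite -sum_c2; apply: sumr_ge0 => p _; apply: sqr_ge0.
  - by rewrite nnegrE expR_ge0.
  apply: le_trans (expR_ge1Dx _); rewrite le_eqVlt; apply/orP; left; apply/eqP.
  by rewrite /Y natrM; field.
have [X0|/ltW X0] := leP 0 X; last by apply: le_trans X0 (expR_ge0 _).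
by rewrite -(@ler_pXn2r _ 4) // nnegrE expR_ge0.
Qed.

(** The inequality says that [A] is within 1 of the integer [i - n], obtained by rounding down; the
    shift by [n] makes the index nonnegative. *)
Lemma grid_sqr_le n (A : R) : `|A| <= n%:R ->
  exists i : 'I_(2 * n).+1, A ^+ 2 <= 2 * (i%:R - n%:R) * A - (i%:R - n%:R) ^+ 2 + 1.
Proof.
move=> /ler_normlP [A1 A2].
have An0 : 0 <= A + n%:R by lra.
have /andP [t1 t2] := truncn_itv An0.
have tn : (Num.truncn (A + n%:R) < (2 * n).+1)%N.
  rewrite ltnS -(ler_nat R); apply: le_trans t1 _; rewrite natrM; lra.
exists (Ordinal tn) => /=; move: t1 t2; rewrite -natr1; move: (_%:R) => i t1 t2.
nra.
Qed.

(** The grid point depends on [a], so its term is bounded by the sum over the whole grid. For a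
    fixed grid point the exponential is a product over the vertices, and the sum over [a] becomes an
    [n]-th power. The 2 in the exponent collects both rounding errors. *)
Lemma sum_prod_cos_le n N (s t : 'I_N -> R) :
  (0 < n)%N -> (forall l, s l ^+ 2 + t l ^+ 2 = 1) ->
  \sum_(a : {ffun 'I_n -> 'I_N}) \prod_(p : 'I_n * 'I_n | (p.1 < p.2)%N)
     (s (a p.1) * s (a p.2) + t (a p.1) * t (a p.2)) <=
  \sum_(i < (2 * n).+1) \sum_(j < (2 * n).+1)
     expR ((2 - n%:R ^+ 2 - (i%:R - n%:R) ^+ 2 - (j%:R - n%:R) ^+ 2) / 8) *
     (\sum_l expR (((i%:R - n%:R) * (s l ^+ 2 - t l ^+ 2) +
                    (j%:R - n%:R) * (2 * s l * t l)) / 4)) ^+ n.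
Proof.
move=> n0 st1.
pose p l := s l ^+ 2 - t l ^+ 2; pose q l := 2 * s l * t l.
have pq1 l : p l ^+ 2 + q l ^+ 2 = 1.
  by rewrite -[RHS](expr1n _ 2) -(st1 l) /p /q; ring.
have le1 (f : 'I_N -> R) (a : 'I_n -> 'I_N) :
    (forall l, f l ^+ 2 <= 1) -> `|\sum_x f (a x)| <= n%:R.
  move=> f1; apply: le_trans (ler_norm_sum _ _ _) _.
  rewrite -[X in _ <= X%:R](card_ord n) -sumr_const; apply: ler_sum => x _.
  by rewrite -(@ler_pXn2r _ 2) ?nnegrE // expr1n real_normK ?num_real.
have p1 l : p l ^+ 2 <= 1 by rewrite -(pq1 l) lerDl sqr_ge0.
have q1 l : q l ^+ 2 <= 1 by rewrite -(pq1 l) lerDr sqr_ge0.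
pose W (i j : 'I_(2 * n).+1) (a : {ffun 'I_n -> 'I_N}) :=
  expR ((2 - n%:R ^+ 2 - (i%:R - n%:R) ^+ 2 - (j%:R - n%:R) ^+ 2) / 8) *
  \prod_x expR (((i%:R - n%:R) * p (a x) + (j%:R - n%:R) * q (a x)) / 4).
have W0 i j a : 0 <= W i j a.
  by rewrite mulr_ge0 ?expR_ge0 // prodr_ge0 // => x _; apply: expR_ge0.
apply: (@le_trans _ _ (\sum_a \sum_i \sum_j W i j a)); last first.
  rewrite exchange_big /=; apply: ler_sum => i _.
  rewrite exchange_big /=; apply: ler_sum => j _.
  rewrite /W -mulr_sumr ler_wpM2l ?expR_ge0 //.
  pose F (x : 'I_n) l := expR (((i%:R - n%:R) * p l + (j%:R - n%:R) * q l) / 4).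
  by rewrite -(bigA_distr_bigA F) /F prodr_const card_ord.
apply: ler_sum => a _.
apply: le_trans (prod_cos_le (s := fun x => s (a x)) (t := fun x => t (a x)) n0 _) _ => //.
have [i Ai] := grid_sqr_le (le1 p a p1); have [j Bj] := grid_sqr_le (le1 q a q1).
apply: (@le_trans _ _ (W i j a)).
  rewrite /W -expR_sum -expRD ler_expR -/(p _) -/(q _).
  move: (i%:R - n%:R) (j%:R - n%:R) Ai Bj => u v Ai Bj.
  have -> : \sum_x (u * p (a x) + v * q (a x)) / 4 =
      (u * \sum_x p (a x) + v * \sum_x q (a x)) / 4.
    by rewrite -mulr_suml big_split /= !mulr_sumr.
  rewrite -[\sum_x (_ - _)]/(\sum_x p (a x)) -[\sum_x (2 * _ * _)]/(\sum_x q (a x)).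
  by move: (\sum_x p (a x)) (\sum_x q (a x)) Ai Bj => A B; lra.
rewrite (bigD1 i) //= (bigD1 j) //= -addrA lerDl addr_ge0 //; apply: sumr_ge0 => *.
  exact: W0.
by apply: sumr_ge0 => *; apply: W0.
Qed.

(* The rate [9 / 20 * n] is [r / 2] for [r = 9 / 10 * n]: grid points of smaller norm [r]
   are negligible because of their factor [expR (- (n%:R - r) ^+ 2 / 8)]. *)
Lemma expR_sub_pow n m (y : R) : 0 <= y <= 1 -> (5 * m <= 2 * n)%N ->
  expR (- (9 / 20 * n%:R * y)) <= (1 - y) ^+ m + expR (- (9 / 200 * n%:R)).
Proof.
move=> /andP [y0 y1] mn; have n0 : 0 <= n%:R :> R := ler0n _ _.
(* From [1 / 10] on, the second summand suffices, as [9 / 20 * 1 / 10] is [9 / 200]. Below,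
   [expR (- (10 / 9 * y)) <= 1 - y], and [10 / 9 * m] is at most [4 / 9 * n], less than
   [9 / 20 * n]. *)
have [ybig|ysmall] := leP (1 / 10) y.
  rewrite ler_wpDl ?exprn_ge0 ?subr_ge0 // ler_expR; nra.
rewrite ler_wpDr ?expR_ge0 //.
have step : expR (- (10 / 9 * y)) <= 1 - y.
  have y1pos : 0 < 1 - y by lra.
  rewrite expRN -[leRHS]invrK lef_pV2 ?posrE ?expR_gt0 ?invr_gt0 //.
  have y1' : 1 - y != 0 by apply/eqP; lra.
  apply: (@le_trans _ _ (expR (y / (1 - y)))).
    have inv_split : (1 - y)^-1 = 1 + y / (1 - y) by field.
    by rewrite {1}inv_split; apply: expR_ge1Dx.
  rewrite ler_expR ler_pdivrMr //; nra.
apply: (@le_trans _ _ (expR (- (10 / 9 * y)) ^+ m)).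
  rewrite -expRM_natl ler_expR.
  have mnR : 5 * m%:R <= 2 * n%:R :> R by rewrite -!natrM ler_nat.
  have : 0 <= y * (2 * n%:R - 5 * m%:R) by rewrite mulr_ge0 // subr_ge0.
  have : 0 <= y * n%:R by rewrite mulr_ge0.
  lra.
by apply: lerXn2r => //; rewrite nnegrE ?expR_ge0 // subr_ge0.
Qed.

Lemma expR_quarter_le2 : expR (1 / 4) <= 2 :> R.
Proof.
have h := expR_ge1Dx (- (1 / 4) : R).
have e : expR (1 / 4) * expR (- (1 / 4)) = 1 :> R by rewrite -expRD subrr expR0.
have := expR_gt0 (1 / 4 : R); nra.
Qed.

(* With [m] close to [2 / 5 * n], the square of [bin_decay m n] is at most
   [10 / (11 * n)] for large [n]; any bound [c / n] with [c < 1] would do. *)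
Definition bin_decay (m n : nat) : R :=
  'C(2 * m, m)%:R / 4 ^+ m + expR (- (9 / 200 * n%:R)).

Lemma bin_decay_ge0 m n : 0 <= bin_decay m n.
Proof. by rewrite addr_ge0 ?expR_ge0 // divr_ge0 ?exprn_ge0. Qed.

Lemma grid_term_le n N m (s t : 'I_N -> R) (u v : R) :
  (0 < n)%N -> (5 * m <= 2 * n)%N ->
  (forall l, s l ^+ 2 + t l ^+ 2 = 1) ->
  (forall al be : R, al ^+ 2 + be ^+ 2 = 1 ->
     \sum_(i < N) ((1 + (al * (s i ^+ 2 - t i ^+ 2) + be * (2 * s i * t i))) / 2) ^+ m
     = N%:R * ('C(2 * m, m)%:R / 4 ^+ m)) ->
  expR ((2 - n%:R ^+ 2 - u ^+ 2 - v ^+ 2) / 8) *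
  (\sum_l expR ((u * (s l ^+ 2 - t l ^+ 2) + v * (2 * s l * t l)) / 4)) ^+ n <=
  2 * (N%:R ^+ n * (expR (- (n%:R ^+ 2 / 800)) + bin_decay m n ^+ n)).
Proof.
move=> n0 mn st1 sumE; set b := bin_decay m n.
pose p l := s l ^+ 2 - t l ^+ 2; pose q l := 2 * s l * t l.
have pq1 l : p l ^+ 2 + q l ^+ 2 = 1.
  by rewrite -[RHS](expr1n _ 2) -(st1 l) /p /q; ring.
have b0 : 0 <= b := bin_decay_ge0 m n.
have nR0 : 0 < n%:R :> R by rewrite ltr0n.
pose r := Num.sqrt (u ^+ 2 + v ^+ 2).
have r0 : 0 <= r := sqrtr_ge0 _.
have r2 : r ^+ 2 = u ^+ 2 + v ^+ 2 by rewrite sqr_sqrtr // addr_ge0 ?sqr_ge0.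
have ler l : u * p l + v * q l <= r.
  apply: le_trans (ler_norm _) _; rewrite -(@ler_pXn2r _ 2) ?nnegrE //.
  rewrite real_normK ?num_real // r2.
  have -> : u ^+ 2 + v ^+ 2 = (u ^+ 2 + v ^+ 2) * (p l ^+ 2 + q l ^+ 2) by rewrite pq1 mulr1.
  by have := sqr_ge0 (u * q l - v * p l); nra.
(* [G] bounds the mean exponential relative to the largest possible value [expR (r / 4)]. Completing
   the square leaves the exponent [1 / 4 - (n - r) ^ 2 / 8]. *)
have reduce G : 0 <= G -> \sum_l expR ((u * p l + v * q l) / 4) <= expR (r / 4) * (N%:R * G) ->
    expR ((2 - n%:R ^+ 2 - u ^+ 2 - v ^+ 2) / 8) *
      (\sum_l expR ((u * p l + v * q l) / 4)) ^+ n <=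
    2 * (N%:R ^+ n * (expR (- ((n%:R - r) ^+ 2 / 8)) * G ^+ n)).
  move=> G0 leG; have sum0 : 0 <= \sum_l expR ((u * p l + v * q l) / 4).
    by apply: sumr_ge0 => l _; apply: expR_ge0.
  apply: (@le_trans _ _ (expR ((2 - n%:R ^+ 2 - u ^+ 2 - v ^+ 2) / 8) *
      (expR (r / 4) * (N%:R * G)) ^+ n)).
    rewrite ler_wpM2l ?expR_ge0 //; apply: lerXn2r => //; rewrite nnegrE //.
    by rewrite !mulr_ge0 ?expR_ge0.
  rewrite exprMn exprMn -expRM_natl [leLHS]mulrA -expRD.
  have -> : (2 - n%:R ^+ 2 - u ^+ 2 - v ^+ 2) / 8 + n%:R * (r / 4) =
      1 / 4 + (- ((n%:R - r) ^+ 2 / 8)).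
    have -> : 2 - n%:R ^+ 2 - u ^+ 2 - v ^+ 2 = 2 - n%:R ^+ 2 - r ^+ 2 by rewrite r2; ring.
    by field.
  rewrite expRD -mulrA; apply: ler_pM => //; rewrite ?expR_ge0 ?mulr_ge0 ?expR_ge0 ?exprn_ge0 //.
    exact: expR_quarter_le2.
  by rewrite mulrCA.
have tail0 : 0 <= expR (- (n%:R ^+ 2 / 800)) :> R := expR_ge0 _.
rewrite -/(p _) -/(q _).
have [rsmall|rbig] := ltP r (9 / 10 * n%:R).
  apply: le_trans (reduce 1 ler01 _) _.
    rewrite mulr1 mulr_natr -[X in _ <= _ *+ X](card_ord N) -sumr_const.
    by apply: ler_sum => l _; rewrite ler_expR ler_pM2r // invr_gt0.
  rewrite expr1n mulr1 ler_wpM2l // ler_wpM2l ?exprn_ge0 //.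
  apply: ler_wpDr; first by rewrite exprn_ge0.
  rewrite ler_expR; nra.
have rpos : 0 < r by lra.
have rn0 : r != 0 by rewrite gt_eqF.
apply: le_trans (reduce b b0 _) _; last first.
  rewrite ler_wpM2l // ler_wpM2l ?exprn_ge0 //.
  apply: ler_wpDl => //; rewrite ler_piMl ?exprn_ge0 // expR_le1 oppr_le0.
  by rewrite divr_ge0 ?sqr_ge0.
(* The cosine of the angle between the grid vector and the [l]-th doubled point. For [y] equal to
   [(1 - h l) / 2], the relative exponential is [expR (- (r / 2 * y))], with [r / 2] at least
   [9 / 20 * n]. *)
pose h l := (u / r) * p l + (v / r) * q l.
have hE l : u * p l + v * q l = r * h l by rewrite /h; field.
have h1 l : -1 <= h l <= 1.
  rewrite -ler_norml -(@ler_pXn2r _ 2) ?nnegrE // real_normK ?num_real // expr1n.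
  have -> : 1 = (p l ^+ 2 + q l ^+ 2) * ((u ^+ 2 + v ^+ 2) / r ^+ 2).
    by rewrite pq1 -r2 divff ?mulr1 // expf_neq0.
  have -> : (p l ^+ 2 + q l ^+ 2) * ((u ^+ 2 + v ^+ 2) / r ^+ 2) =
     h l ^+ 2 + (u / r * q l - v / r * p l) ^+ 2 by rewrite /h; field.
  by rewrite lerDl sqr_ge0.
rewrite /b /bin_decay mulrDr -(sumE (u / r) (v / r)); last first.
  by rewrite !expr_div_n -mulrDl -r2 divff // expf_neq0.
rewrite mulr_natl -[X in _ + _ *+ X](card_ord N) -sumr_const -big_split mulr_sumr /=.
apply: ler_sum => l _; rewrite hE -/(p _) -/(q _) -/(h l).
have -> : r * h l / 4 = r / 4 + (- (r * (1 - h l) / 4)) by ring.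
rewrite expRD ler_wpM2l ?expR_ge0 //.
have /andP [hl1 hl2] := h1 l.
have yI : 0 <= (1 - h l) / 2 <= 1 by apply/andP; split; lra.
apply: le_trans _ (le_trans (expR_sub_pow yI mn) _).
  by rewrite ler_expR; nra.
by have -> : 1 - (1 - h l) / 2 = (1 + h l) / 2 by field.
Qed.

Lemma regular_count_bound n m : (0 < n)%N -> (5 * m <= 2 * n)%N ->
  #|[pred g : {ffun 'I_n * 'I_n -> bool} | regular (tournament_of g)]|%:R <=
  2 ^+ (n * n) * ((2 * n).+1%:R ^+ 2 *
    (2 * (expR (- (n%:R ^+ 2 / 800)) + bin_decay m n ^+ n))) :> R.
Proof.
(* The least [N] for which the cosine power mean is exact; its power [N ^ n] cancels. *)
move=> n0 mn; pose N := (4 * m).+1.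
have [s [t [st1 count sumE]]] := @circle_points R N isT.
have N0 : 0 < N%:R ^+ n :> R by rewrite exprn_gt0 ?ltr0n.
rewrite -(ler_pM2r N0) -natrX -natrM; apply: le_trans (count n) _.
rewrite -mulrA ler_wpM2l ?exprn_ge0 //.
apply: le_trans (sum_prod_cos_le n0 st1) _.
set Q := expR _ + _.
apply: (@le_trans _ _ (\sum_(i < (2 * n).+1) \sum_(j < (2 * n).+1)
    2 * (N%:R ^+ n * Q))).
  apply: ler_sum => i _; apply: ler_sum => j _; apply: grid_term_le => // al be.
  exact: sumE.
rewrite !sumr_const card_ord -[X in X *+ _]mulr_natr -mulr_natr natrX.
by rewrite le_eqVlt; apply/orP; left; apply/eqP; ring.
Qed.

(** The left factor of [expR (x / 800) = expR (x / 3200) ^+ 4] is at least [x / 3200], and a fourth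
    power eventually beats a cube. *)
Lemma expR_ge_cube : exists2 M : R, 100 <= M &
  forall x, M <= x -> 100 * x ^+ 3 <= expR (x / 800).
Proof.
pose c : R := 800 * 4; have c1 : 1 <= c by rewrite /c; lra.
have c4 : 1 <= c ^+ 4 by rewrite exprn_ege1.
exists (100 * c ^+ 4) => [|x Mx]; first by rewrite ler_peMr.
have x0 : 0 < x by lra.
apply: (@le_trans _ _ ((x / c) ^+ 4)).
  rewrite expr_div_n ler_pdivlMr; last by lra.
  by rewrite mulrAC [x ^+ 4]exprS ler_wpM2r // exprn_ge0 // ltW.
have -> : x / 800 = 4 * (x / c) by rewrite /c; field.
rewrite expRM_natl; apply: lerXn2r; rewrite ?nnegrE ?expR_ge0 //.
  by apply: divr_ge0; lra.
by apply: le_trans (expR_ge1Dx _); rewrite lerDr.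
Qed.

(** Here [3 * m + 1] is at least [115 / 100 * n], so the binomial part contributes at most
    [100 / 115]; the gap to [10 / 11] absorbs the terms containing [T]. *)
Lemma bin_decay_sqr_le m n : (2 * n < 5 * m.+1)%N -> 100 <= n%:R :> R ->
  100 * n%:R ^+ 3 <= expR (n%:R / 800) :> R ->
  n%:R * bin_decay m n ^+ 2 <= 10 / 11.
Proof.
move=> mn; rewrite /bin_decay; set x : R := n%:R => x100 xexp.
set be := _ / _; set T := expR _.
have be0 : 0 <= be by rewrite divr_ge0 ?exprn_ge0.
have be2 : be ^+ 2 * (3 * m%:R + 1) <= 1.
  rewrite /be expr_div_n -exprM mulrAC ler_pdivrMr ?exprn_gt0 ?ltr0n // mul1r.
  have := central_bin_bound m; rewrite -(ler_nat R) natrM !natrX -natr1 natrM.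
  have -> : 16 = 4 ^+ 2 :> R by rewrite -natrX.
  by rewrite -exprM mulnC.
have mx : 5 * m%:R + 5 >= 2 * x :> R.
  have := ltnW mn; rewrite -(ler_nat R) !natrM -natr1; rewrite -/x; lra.
have T0 : 0 <= T := expR_ge0 _.
have TE : T * (100 * x ^+ 3) <= 1.
  apply: (@le_trans _ _ (T * expR (x / 800))); first by rewrite ler_wpM2l.
  by rewrite -expRD expR_le1; lra.
have x3 : 1 <= x ^+ 2 by nra.
have Tx : T * (100 * x) <= 1 / 100.
  have : T * (100 * x) * 10000 <= T * (100 * x ^+ 3).
    have -> : T * (100 * x ^+ 3) = T * (100 * x) * x ^+ 2 by ring.
    by apply: ler_wpM2l; [rewrite !mulr_ge0 //; lra | nra].
  lra.
have be1 : be <= 1.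
  rewrite -(@ler_pXn2r _ 2) ?nnegrE // expr1n.
  have : 0 <= m%:R :> R by rewrite ler0n.
  have := sqr_ge0 be; nra.
have T1 : T <= 1 by rewrite expR_le1; lra.
have bex : x * be ^+ 2 * (115 / 100) <= 1.
  apply: le_trans be2; have : 115 / 100 * x <= 3 * m%:R + 1 by lra.
  by have := sqr_ge0 be; nra.
have -> : x * (be + T) ^+ 2 = x * be ^+ 2 + (T * x) * (2 * be + T) by ring.
have Tx0 : 0 <= T * x by rewrite mulr_ge0 //; lra.
have : (T * x) * (2 * be + T) <= (T * x) * 3 by apply: ler_wpM2l => //; lra.
lra.
Qed.

(** Squaring [K = 2 ^ (n * s)] gives at most [n ^ n]. Against this, either error term is still at
    most [e = expR (- (n / 22))], which also outweighs the polynomial number of grid points. *)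
Lemma regular_rare : exists n0, forall n s : nat, (n0 <= n)%N -> (4 ^ s < n)%N ->
  (#|[pred g : {ffun 'I_n * 'I_n -> bool} | regular (tournament_of g)]| * 2 ^ (n * s)
   < 2 ^ (n * n))%N.
Proof.
have [M M100 expM] := expR_ge_cube.
have M0 : 0 <= M by lra.
have /andP [_ ltM] := truncn_itv M0.
exists (Num.truncn M).+1 => n s n0n s4.
set c := #|_|; pose x : R := n%:R.
have Mx : M <= x by apply: ltW (lt_le_trans ltM _); rewrite ler_nat.
have x100 : 100 <= x by lra.
have xexp := expM x Mx.
have n0 : (0 < n)%N by apply: leq_ltn_trans s4.
pose m := ((2 * n) %/ 5)%N.
have m1 : (5 * m <= 2 * n)%N by rewrite [(5 * _)%N]mulnC leq_trunc_div.
have m2 : (2 * n < 5 * m.+1)%N by rewrite [(5 * _)%N]mulnC ltn_ceil.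
have := regular_count_bound n0 m1; rewrite -/c -/x.
have := bin_decay_sqr_le m2 x100 xexp; rewrite -/x.
have := bin_decay_ge0 m n.
move: (bin_decay m n) => b b0 b2 count.
pose K : R := 2 ^+ (n * s); have K0 : 0 <= K by rewrite exprn_ge0.
have K2 : K ^+ 2 <= x ^+ n.
  have -> : K ^+ 2 = (4 ^ s)%:R ^+ n.
    rewrite /K natrX -!exprM [(s * n)%N]mulnC; have -> : 4 = 2 ^+ 2 :> R by rewrite -natrX.
    by rewrite -exprM mulnC.
  by apply: lerXn2r; rewrite ?nnegrE ?ler0n // ler_nat ltnW.
pose e := expR (- (x / 22)).
have e0 : 0 <= e := expR_ge0 _.
have e2 : e ^+ 2 = expR (- (x / 11)) by rewrite -expRM_natl; congr expR; field.
have small y : 0 <= y -> x ^+ n * y ^+ 2 <= e ^+ 2 -> K * y <= e.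
  move=> y0 le; rewrite -(@ler_pXn2r _ 2) ?nnegrE ?mulr_ge0 // exprMn.
  by apply: le_trans le; rewrite ler_wpM2r ?sqr_ge0.
have E1 : K * expR (- (x ^+ 2 / 800)) <= e.
  apply: small; rewrite ?expR_ge0 // e2.
  apply: (@le_trans _ _ (expR (x / 800) ^+ n * expR (- (x ^+ 2 / 800)) ^+ 2)).
    rewrite ler_wpM2r ?exprn_ge0 ?expR_ge0 //; apply: lerXn2r; rewrite ?nnegrE ?expR_ge0 ?ler0n //.
    apply: le_trans xexp; rewrite exprS mulrCA ler_peMr ?ler0n //.
    by rewrite expr2; nra.
  rewrite -!expRM_natl -expRD ler_expR -/x; nra.
(* After squaring, the base is [x * b ^+ 2 <= 10 / 11], which is [1 - 1 / 11], hence at most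
   [expR (- (1 / 11))]. *)
have E2 : K * b ^+ n <= e.
  apply: small; rewrite ?exprn_ge0 // e2 -exprM mulnC exprM -exprMn.
  have -> : - (x / 11) = n%:R * (- (1 / 11)) by rewrite -/x; field.
  rewrite expRM_natl; apply: lerXn2r; rewrite ?nnegrE ?mulr_ge0 ?sqr_ge0 ?expR_ge0 ?ler0n //.
  by apply: le_trans b2 _; apply: le_trans (expR_ge1Dx _); lra.
have eL : 4 * (2 * n).+1%:R ^+ 2 * e < 1.
  rewrite -[(2 * n).+1%:R]natr1 natrM -/x /e expRN ltr_pdivrMr ?expR_gt0 // mul1r.
  apply: lt_le_trans (_ : _ < 100 * x ^+ 3) _.
    rewrite [x ^+ 3]exprS; nra.
  by apply: le_trans xexp _; rewrite ler_expR; lra.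
rewrite -(ltr_nat R) natrM !natrX -/K.
apply: (@le_lt_trans _ _ (2 ^+ (n * n) * (4 * (2 * n).+1%:R ^+ 2 * e))).
  apply: le_trans (ler_wpM2r K0 count) _; rewrite -[leLHS]mulrA ler_wpM2l ?exprn_ge0 //.
  have -> : 4 * (2 * n).+1%:R ^+ 2 * e = (2 * n).+1%:R ^+ 2 * (4 * e) by ring.
  by rewrite -[leLHS]mulrA ler_wpM2l ?sqr_ge0 //; lra.
by rewrite gtr_pMr // exprn_gt0.
Qed.
End RegularTournamentCount.

(** * Lower bound *)

(** The two cuts isolating [x] give out- and in-degree at least [k], and the degrees add up to at
    most [2 * k]. *)
Lemma arc_strong_regular k (D : rel 'I_(2 * k).+1) :
  0 < k -> is_tournament D -> k_arc_strong k D -> regular D.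
Proof.
move=> k0 [Dirr Dasym] strD; apply/forallP => x.
have x0 : [set x] != set0 by apply/set0Pn; exists x; rewrite inE.
have xC0 : ~: [set x] != set0.
  by rewrite -card_gt0 cardsC1 card_ord /=; lia.
have out : k <= outdeg D x.
  apply: leq_trans (strD _ x0 xC0) _.
  apply: leq_trans (_ : _ <= #|pair x @: [set y | D x y]|) _; last first.
    apply: leq_trans (leq_imset_card _ _) _.
    by rewrite leq_eqVlt; apply/orP; left; apply/eqP; apply: eq_card => y; rewrite !inE.
  apply: subset_leq_card; apply/subsetP => -[a b]; rewrite !inE /= => /and3P [/eqP -> _ Dxb].
  by apply/imsetP; exists b; rewrite ?inE.
have inn : k <= indeg D x.
  have := strD (~: [set x]) xC0; rewrite setCK => /(_ x0) /leq_trans; apply.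
  apply: leq_trans (_ : _ <= #|(fun y => (y, x)) @: [set y | D y x]|) _; last first.
    apply: leq_trans (leq_imset_card _ _) _.
    by rewrite leq_eqVlt; apply/orP; left; apply/eqP; apply: eq_card => y; rewrite !inE.
  apply: subset_leq_card; apply/subsetP => -[a b]; rewrite !inE /= => /and3P [_ /eqP -> Dxb].
  by apply/imsetP; exists a; rewrite ?inE.
have le2k : outdeg D x + indeg D x <= 2 * k.
  apply: leq_trans (_ : _ <= #|~: [set x]|) _; last by rewrite cardsC1 card_ord.
  rewrite /outdeg /indeg -cardUI [X in _ + X](_ : _ = 0) ?addn0; last first.
    apply: eq_card0 => y; rewrite !inE; have [->|] := eqVneq y x.
      by rewrite (negbTE (Dirr x)).
    by move=> /Dasym; case: (D y x); case: (D x y).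
  apply: subset_leq_card; apply/subsetP => y; rewrite !inE.
  by apply: contraL => /eqP ->; rewrite (negbTE (Dirr x)).
by apply/eqP; lia.
Qed.

Lemma tournament_of_tournament n (g : {ffun 'I_n * 'I_n -> bool}) :
  is_tournament (tournament_of g).
Proof.
split=> [x|x y]; rewrite /tournament_of; first by rewrite ltnn.
rewrite -val_eqE /=; case: ltngtP => //= _ _; by case: (g _).
Qed.

Definition inversion_parity n (Xs : seq {set 'I_n}) (x y : 'I_n) : bool :=
  odd (count (fun X : {set 'I_n} => (x \in X) && (y \in X)) Xs).

Lemma inversion_parityC n (Xs : seq {set 'I_n}) x y :
  inversion_parity Xs x y = inversion_parity Xs y x.
Proof. by rewrite /inversion_parity; congr odd; apply: eq_count => X; rewrite andbC. Qed.

Lemma invert_seq_parity n (D : rel 'I_n) Xs x y :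
  is_tournament D -> x != y ->
  invert_seq D Xs x y = D x y (+) inversion_parity Xs x y.
Proof.
rewrite /invert_seq /inversion_parity => tD neq.
elim: Xs D tD => [|X Xs IH] D tD /=; first by rewrite addbF.
rewrite IH; last exact: invert_tournament.
rewrite oddD addbA; congr (_ (+) _); rewrite /invert.
have [_ /(_ x y neq)] := tD.
by case: (_ && _) => /=; case: (D x y); case: (D y x).
Qed.

(** The effect of inversions on codes. Flipping at all pairs, even those that encode no arc, makes
    it an involution. *)
Definition flip_inversions n (Xs : seq {set 'I_n}) (g : {ffun 'I_n * 'I_n -> bool}) :=
  [ffun p => g p (+) inversion_parity Xs p.1 p.2].

Lemma flip_inversionsK n (Xs : seq {set 'I_n}) : involutive (flip_inversions Xs).
Proof. by move=> g; apply/ffunP => p; rewrite !ffunE addbK. Qed.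

Lemma invert_seq_tournament_of n Xs (g : {ffun 'I_n * 'I_n -> bool}) :
  invert_seq (tournament_of g) Xs =2 tournament_of (flip_inversions Xs g).
Proof.
move=> x y; have tg := tournament_of_tournament g.
have [->|neq] := eqVneq x y.
  have [/(_ y)/negbTE -> _] := invert_seq_tournament Xs tg.
  by have [/(_ y)/negbTE -> _] := tournament_of_tournament (flip_inversions Xs g).
rewrite invert_seq_parity // /tournament_of !ffunE /=.
case: ltngtP => [//|_|/val_inj eq]; last by rewrite eq eqxx in neq.
by rewrite inversion_parityC addNb.
Qed.

Lemma eq_regular n (D E : rel 'I_n) : D =2 E -> regular D = regular E.
Proof.
move=> eqDE; apply: eq_forallb => x; rewrite /outdeg /indeg.
by congr (_ == _); apply: eq_card => y; rewrite !inE eqDE.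
Qed.

Lemma inversion_parity_pad n (Xs : seq {set 'I_n}) j x y :
  inversion_parity (Xs ++ nseq j set0) x y = inversion_parity Xs x y.
Proof.
rewrite /inversion_parity count_cat [X in _ + X](_ : _ = 0) ?addn0 //.
by rewrite count_nseq inE mul0n.
Qed.

(** At most [2 ^ (n * s)] codes arise from each regular one by [s] inversions, so some code [g] is
    missed. If at most [s] sets made its tournament [k]-arc-strong, undoing them from the regular
    result would reach [g]. *)
Lemma hard_tournament k s :
  0 < k ->
  let n := (2 * k).+1 in
  #|[pred g : {ffun 'I_n * 'I_n -> bool} | regular (tournament_of g)]| * 2 ^ (n * s)
    < 2 ^ (n * n) ->
  exists T : rel 'I_n, is_tournament T /\
    forall Xs, k_arc_strong k (invert_seq T Xs) -> s < size Xs.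
Proof.
move=> k0 n few.
pose P := setX [set: s.-tuple {set 'I_n}]
               [set g : {ffun 'I_n * 'I_n -> bool} | regular (tournament_of g)].
pose f (w : s.-tuple {set 'I_n} * {ffun 'I_n * 'I_n -> bool}) := flip_inversions w.1 w.2.
have cardP : #|f @: P| < #|{: {ffun 'I_n * 'I_n -> bool}}|.
  apply: leq_ltn_trans (leq_imset_card _ _) _.
  rewrite cardsX cardsT card_tuple card_ffun card_prod card_bool card_ord.
  have -> : #|{: {set 'I_n}}| = 2 ^ n.
    by rewrite -cardsT -powersetT card_powerset cardsT card_ord.
  by rewrite -expnM cardsE mulnC.
have [g gP] : exists g, g \notin f @: P.
  apply/existsP; apply: contraTT cardP => /existsPn all; rewrite -leqNgt.
  by apply: subset_leq_card; apply/subsetP => g _; have := all g; rewrite negbK.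
exists (tournament_of g); split=> [|Xs strX]; first exact: tournament_of_tournament.
rewrite ltnNge; apply: contra gP => szX.
(* Inverting the empty set does nothing, so shorter sequences are padded to length exactly [s]. *)
have szp : size (Xs ++ nseq (s - size Xs) set0) == s.
  by rewrite size_cat size_nseq subnKC.
apply/imsetP; exists (Tuple szp, flip_inversions Xs g); last first.
  rewrite /f /= -{1}(flip_inversionsK Xs g); apply/ffunP => p.
  by rewrite !ffunE inversion_parity_pad.
rewrite !inE /= -(eq_regular (@invert_seq_tournament_of _ Xs g)).
apply: arc_strong_regular strX => //; apply: invert_seq_tournament.
exact: tournament_of_tournament.
Qed.

Lemma Rexp_is_exponential : @is_exponential Rdefinitions.R Rtrigo_def.exp.
Proof. by split=> [x y|x]; [exact: exp_plus | apply/RleP; exact: exp_ineq1_le]. Qed.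

Lemma hard_tournament_exists : exists K, forall k, K <= k ->
  exists T : rel 'I_(2 * k).+1, is_tournament T /\
    forall Xs, k_arc_strong k (invert_seq T Xs) -> (2 * k).+1 <= 4 ^ size Xs.
Proof.
have [n0 rare] := regular_rare Rexp_is_exponential.
exists n0.+1 => k le_k.
(* The largest exponent that [regular_rare] allows for [n = 2 * k + 1]; needing more sets than this
   means [2 * k + 1 <= 4 ^ size Xs]. *)
have lt4 : 4 ^ trunc_log 4 (2 * k) < (2 * k).+1 by rewrite ltnS trunc_logP //; lia.
have [||T [tT hardT]] := @hard_tournament k (trunc_log 4 (2 * k)).
- by lia.
- by apply: rare lt4; lia.
exists T; split=> // Xs /hardT; rewrite ltnNge; apply: contraNltn => h.
exact: trunc_log_max.
Qed.

(** * Existence and comparison of the extremal values *)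

Lemma ex_max_nat (P : nat -> Prop) b :
  (exists m, P m) -> (forall m, P m -> m <= b) ->
  exists m, P m /\ forall j, P j -> j <= m.
Proof.
move=> [m0 Pm0] leb.
have exP : exists m, `[< P m >] by exists m0; apply/asboolP.
have leP m : `[< P m >] -> m <= b by move/asboolP/leb.
case: (ex_maxnP exP leP) => m /asboolP Pm max; exists m; split=> // j Pj.
by apply: max; apply/asboolP.
Qed.

Lemma ex_min_size T (P : seq T -> Prop) (xs0 : seq T) : P xs0 ->
  exists s, ((exists xs, size xs = s /\ P xs) /\ (forall xs, P xs -> s <= size xs))
            /\ s <= size xs0.
Proof.
move=> Pxs0; pose Q s := exists xs, size xs = s /\ P xs.
have exQ : exists s, `[< Q s >] by exists (size xs0); apply/asboolP; exists xs0.
case: (ex_minnP exQ) => s /asboolP Qs min; exists s; split; last first.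
  by apply: min; apply/asboolP; exists xs0.
by split=> // xs Pxs; apply: min; apply/asboolP; exists xs.
Qed.

Theorem theorem1p7 :
  exists K : nat, forall k : nat, K <= k ->
    exists m' m : nat,
      [/\ is_M_arc k m', is_M k m,
          Rle (Rmult (Rinv (INR 2)) (log2 (INR (2 * k).+1))) (INR m'),
          m' <= m & m <= 2 * k].
Proof.
have [K hard] := hard_tournament_exists; exists K => k /hard [T [tT hardT]].
have ex_sinv n (D : rel 'I_n) : is_tournament D -> (2 * k).+1 <= n ->
    exists s, is_sinv k D s /\ s <= 2 * k.
  move=> tD le_kn; have [Xs [szX strX]] := k_strong_inversions tD le_kn.
  have [s [sP le_s]] := ex_min_size (P := fun Ys => k_strong k (invert_seq D Ys)) strX.
  by exists s; rewrite -szX.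
have ex_sinv_arc n (D : rel 'I_n) s : (2 * k).+1 <= n -> is_sinv k D s ->
    exists s', is_sinv_arc k D s' /\ s' <= s.
  move=> le_kn [[Xs [szX strX]] _].
  have [s' [s'P le_s']] := ex_min_size (P := fun Ys => k_arc_strong k (invert_seq D Ys))
    (k_strong_arc_strong le_kn strX).
  by exists s'; rewrite -szX.
pose P m := exists (n : nat) (D : rel 'I_n),
  [/\ is_tournament D, (2 * k).+1 <= n & is_sinv k D m].
pose P' m := exists (n : nat) (D : rel 'I_n),
  [/\ is_tournament D, (2 * k).+1 <= n & is_sinv_arc k D m].
have [s [sT le_s]] := ex_sinv _ T tT (leqnn _).
have [s' [s'T le_s']] := ex_sinv_arc _ T s (leqnn _) sT.
have P_le m : P m -> m <= 2 * k.
  move=> [n [D [tD le_kn [_ minD]]]].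
  by have [Xs [<- strX]] := k_strong_inversions tD le_kn; apply: minD.
have P'_le m : P' m -> m <= 2 * k.
  move=> [n [D [tD le_kn [_ minD]]]].
  have [Xs [<- strX]] := k_strong_inversions tD le_kn; apply: minD.
  exact: k_strong_arc_strong.
(* The tournaments are of unbounded order, but the values are at most [2 * k], and [T] shows that
   there is one; so the maximum exists. *)
have [m [Pm maxm]] : exists m, P m /\ forall j, P j -> j <= m.
  by apply: ex_max_nat P_le; exists s, (2 * k).+1, T.
have [m' [P'm' maxm']] : exists m, P' m /\ forall j, P' j -> j <= m.
  by apply: ex_max_nat P'_le; exists s', (2 * k).+1, T.
exists m', m; split.
- split=> // n D tD le_kn; have [j [jD _]] := ex_sinv n D tD le_kn.
  have [j' [j'D _]] := ex_sinv_arc n D j le_kn jD.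
  by exists j'; split=> //; apply: maxm'; exists n, D.
- split=> // n D tD le_kn; have [j [jD _]] := ex_sinv n D tD le_kn.
  by exists j; split=> //; apply: maxm; exists n, D.
- apply: half_log2_le => //; have [[Xs [szX strX]] _] := s'T.
  apply: leq_trans (hardT Xs strX) _; rewrite szX leq_exp2l //.
  by apply: maxm'; exists (2 * k).+1, T.
(* On a tournament attaining [m'], an optimal sequence for [k]-strength also gives
   [k]-arc-strength. *)
- have [n [D [tD le_kn [_ minD]]]] := P'm'.
  have [j [jD _]] := ex_sinv n D tD le_kn.
  have [[Xs [szX strX]] _] := jD.
  apply: leq_trans (minD Xs (k_strong_arc_strong le_kn strX)) _; rewrite szX.
  by apply: maxm; exists n, D.
- exact: P_le.
Qed.
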